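(* For each $k\in\mathbb{N}$, the family of finite $k$-stable graphs has the Erdős–Hajnal property; that is, for each $k\in\mathbb{N}$ there exists a real number $\epsilon>0$ such that every finite $k$-stable graph $G$ has a clique or an anti-clique of size $\geq |G|^{\epsilon}$.
   Context: A graph $G=(V,E)$ is a vertex set $V$ with a symmetric anti-reflexive binary relation $E$ on $V$; $|G|$ denotes $|V|$. A clique is a set of pairwise adjacent vertices, and an anti-clique is a set of pairwise non-adjacent vertices. For $k\in\mathbb{N}$, a graph $G=(V,E)$ is $k$-stable if there do not exist $a_1,\dots,a_k\in V$ and $b_1,\dots,b_k\in V$ such that, for all $i,j\in\{1,\dots,k\}$, $E(a_i,b_j)$ holds if and only if $i\leq j$. A family of finite graphs has the Erdős–Hajnal property if there is $\epsilon>0$ such that every graph $G$ in the family has a clique or an anti-clique of size $\geq |G|^\epsilon$. *)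

(* Defs.v *)
From HB Require Import structures.
From mathcomp Require Import all_boot all_order all_algebra.
From mathcomp Require Import all_classical all_reals all_analysis.

Set Implicit Arguments.
Unset Strict Implicit.
Unset Printing Implicit Defensive.

Import Order.TTheory GRing.Theory Num.Theory.

Local Open Scope ring_scope.

Record fgraph : Type := FGraph {
  vertex :> finType;
  edge : rel vertex;
  edge_sym : symmetric edge;
  edge_irr : irreflexive edge
}.

Definition clique (G : fgraph) (S : {set G}) : Prop :=
  {in S &, forall x y : G, x != y -> edge x y}.

Definition anticlique (G : fgraph) (S : {set G}) : Prop :=
  {in S &, forall x y : G, x != y -> ~~ edge x y}.

(* The indices run over 0, ..., k-1 instead of 1, ..., k.  For k = 0 the empty
   sequences are a witness, so that no graph is 0-stable. *)
Definition stable (k : nat) (G : fgraph) : Prop :=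
  ~ exists a b : 'I_k -> G,
      forall i j : 'I_k, edge (a i) (b j) <-> (i <= j)%N.

(* For the empty graph, 0 `^ eps = 0 since eps > 0. *)
Definition erdos_hajnal (R : realType) (F : fgraph -> Prop) : Prop :=
  exists2 eps : R, 0 < eps &
    forall G : fgraph, F G ->
      exists2 S : {set G}, clique S \/ anticlique S &
        #|G|%:R `^ eps <= #|S|%:R.

(* Main.v *)
Require Import Defs.
From HB Require Import structures.
From mathcomp Require Import all_boot all_order all_algebra.
From mathcomp Require Import all_classical all_reals all_analysis.
From mathcomp Require Import zify.

(** A set A of vertices is q-good when every vertex is adjacent to fewer than
    |A|/q elements of A, or to all but fewer than |A|/q of them.  Splitting sets
    that are not q-good along a witness builds a binary tree; its height is
    bounded in a k-stable graph by some d(k), since a tall tree yields a half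
    graph.  Hence there is a q-good A with |A| >= n / q^d.  At least half of the
    elements of A are of the same kind (few neighbours in A, or few
    non-neighbours), and a maximal homogeneous set among these has size at least
    q/4 as soon as |A| >= q.  The choice q ~ n^(1/(d+1)) concludes. *)

Set Implicit Arguments.
Unset Strict Implicit.
Unset Printing Implicit Defensive.

Import Order.TTheory GRing.Theory Num.Theory.

Section Trees.
Variables (T : finType) (e : rel T).
Implicit Types (A B : {set T}) (s : seq (T * T)).

(** Full binary trees as in Shelah's 2-rank (Littlestone dimension): inner nodes are labelled in [B]
    and every branch is realized in [A]. Only [A] shrinks on the way down. *)
Fixpoint has_tree (d : nat) A B : Prop :=
  if d is d'.+1 then
    exists2 b, b \in B & has_tree d' [set x in A | e x b] B
                      /\ has_tree d' [set x in A | ~~ e x b] B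
  else exists x, x \in A.

Lemma sub_has_tree d A A' B B' : A \subset A' -> B \subset B' ->
  has_tree d A B -> has_tree d A' B'.
Proof.
elim: d A A' => [|d IHd] A A' sAA' sBB' /=.
  by case=> x xA; exists x; apply: (fintype.subsetP sAA').
case=> b bB [t1 t0]; exists b; first exact: (fintype.subsetP sBB').
split; [apply: IHd t1 | apply: IHd t0] => //; apply/fintype.subsetP=> x;
  by rewrite !inE => /andP[/(fintype.subsetP sAA')-> ->].
Qed.

Lemma has_tree_neq0 d A B : has_tree d A B -> exists x, x \in A.
Proof.
elim: d A => [//|d IHd] A [b _ [/IHd[x]]].
by rewrite inE => /andP[xA _] _; exists x.
Qed.

(** Ramsey property for trees with two-coloured labels. If the root is in [B], either one of its
    subtrees already yields the tree over [B'], or both yield trees over [B] one level short, which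
    the root joins; the case of [B'] is symmetric. *)
Lemma has_treeU p q A B B' : has_tree (p + q) A (B :|: B') ->
  has_tree p A B \/ has_tree q A B'.
Proof.
have [n] := ubnP (p + q); elim: n p q A => // n IHn [|p] [|q] A len t.
- by left; apply: has_tree_neq0 t.
- by left; apply: has_tree_neq0 t.
- by right; apply: has_tree_neq0 t.
have sA (P : pred T) : [set x in A | P x] \subset A.
  by apply/fintype.subsetP=> x; rewrite inE => /andP[].
rewrite addSn in t; case: t => b; rewrite inE => /orP[bB|bB'] [t1 t0].
- have [|t1'|t1'] := IHn p q.+1 _ _ t1; first lia.
    have [|t0'|t0'] := IHn p q.+1 _ _ t0; first lia.
      by left; exists b.
    by right; apply: sub_has_tree t0'.
  by right; apply: sub_has_tree t1'.
- have pqE : p + q.+1 = p.+1 + q by lia.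
  rewrite pqE in t1 t0.
  have [|t1'|t1'] := IHn p.+1 q _ _ t1; first lia.
    by left; apply: sub_has_tree t1'.
  have [|t0'|t0'] := IHn p.+1 q _ _ t0; first lia.
    by left; apply: sub_has_tree t0'.
  by right; exists b.
Qed.

(* The diagonal of the half graph is left unconstrained, so that the induction
   in [has_tree_half] can extend it at either end. *)
Definition half_rel (x y : T * T) := e x.1 y.2 && ~~ e y.1 x.2.

(** The doubling pays for one use of [has_treeU], the successor for the root that becomes part of a
    new pair. *)
Fixpoint tree_height (m : nat) : nat :=
  if m is m'.+1 then (tree_height m').+1 + (tree_height m').+1 else 0.

Lemma has_tree_half m A B : has_tree (tree_height m) A B ->
  exists s, [/\ size s = m, pairwise half_rel s
              & all (fun x => (x.1 \in A) && (x.2 \in B)) s].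
Proof.
elim: m A B => [|m IHm] A B; first by exists [::].
move=> t; have [h hA] := has_tree_neq0 t.
have defB : B = [set b in B | e h b] :|: [set b in B | ~~ e h b].
  by apply/setP=> b; rewrite !inE; case: (b \in B); case: (e h b).
move: t; rewrite [tree_height _]/= {1}defB => /has_treeU[].
(* All labels are adjacent to [h]; below the root [b], the non-neighbours of [b] are kept, so
   [(h, b)] can come first. *)
- case=> b; rewrite inE => /andP[bB hb] [_ /IHm[s [ss ps /allP sP]]].
  exists ((h, b) :: s); split; first by rewrite /= ss.
    rewrite /= ps andbT; apply/allP=> x /sP.
    by rewrite !inE /half_rel /= => /andP[/andP[_ ->] /andP[_ ->]].
  rewrite /= hA bB; apply/allP=> x /sP.
  by rewrite !inE => /andP[/andP[-> _] /andP[-> _]].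
(* No label is adjacent to [h]; the neighbours of [b] are kept, so [(h, b)] can come last. *)
- case=> b; rewrite inE => /andP[bB hb] [/IHm[s [ss ps /allP sP]] _].
  exists (rcons s (h, b)); split; first by rewrite size_rcons ss.
    rewrite pairwise_rcons ps andbT; apply/allP=> x /sP.
    by rewrite !inE /half_rel /= => /andP[/andP[_ ->] /andP[_ ->]].
  rewrite all_rcons /= hA bB; apply/allP=> x /sP.
  by rewrite !inE => /andP[/andP[-> _] /andP[-> _]].
Qed.

Definition good (q : nat) A := forall b,
  q * #|[set x in A | e x b]| < #|A| \/ q * #|[set x in A | ~~ e x b]| < #|A|.

(** Both sides of a split keep at least |A|/q elements, so each level costs a factor [q]. If neither
    side leads to a good set, their trees are joined under the witness. *)
Lemma good_or_tree q d A : 0 < q -> A != finset.set0 ->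
  (exists A', [/\ A' != finset.set0, good q A' & #|A| <= #|A'| * q ^ d])
  \/ has_tree d A [set: T].
Proof.
move=> q0; elim: d A => [|d IHd] A A0; first by right; apply/set0Pn.
have [gA|/existsNP[b /not_orP[/negP n1 /negP n0]]] := pselect (good q A).
  by left; exists A; split=> //; rewrite leq_pmulr // expn_gt0 q0.
have branch A1 : ~~ (q * #|A1| < #|A|) ->
    (exists A', [/\ A' != finset.set0, good q A' & #|A| <= #|A'| * q ^ d.+1])
    \/ has_tree d A1 [set: T].
  rewrite -leqNgt => leA; have : 0 < q * #|A1|.
    by apply: leq_trans leA; rewrite card_gt0.
  rewrite muln_gt0 card_gt0 => /andP[_ /IHd[[A' [A'0 gA' leA']]|]]; last by right.
  left; exists A'; split=> //; apply: leq_trans leA _.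
  by rewrite expnS mulnCA leq_mul2l leA' orbT.
have [?|t1] := branch _ n1; first by left.
have [?|t0] := branch _ n0; first by left.
by right; exists b; rewrite ?inE.
Qed.

(* A maximal independent subset of A' dominates A'. *)
Lemma sparse_independent q A A' : 0 < q -> symmetric e -> A' \subset A ->
  {in A', forall b, q * #|[set x in A | e x b]| <= #|A|} ->
  exists2 S : {set T}, {in S &, forall x y, x != y -> ~~ e x y}
    & q * #|A'| <= #|S| * (q + #|A|).
Proof.
move=> q0 esym /fintype.subsetP sA'A sparse.
pose P (S : {set T}) := (S \subset A') &&
  [forall x in S, forall y in S, (x != y) ==> ~~ e x y].
have P0 : P finset.set0.
  by rewrite /P finset.sub0set; apply/forall_inP=> x; rewrite inE.
have [S /maxsetP[/andP[/fintype.subsetP sSA' /forall_inP indS] maxS] _] :=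
  maxset_exists P0.
have indS' : {in S &, forall x y, x != y -> ~~ e x y}.
  by move=> x y /indS/forall_inP h /h /implyP.
exists S => //.
have cover : A' \subset \bigcup_(b in S) (b |: [set x in A | e x b]).
  apply/fintype.subsetP=> x xA'; apply: contraT => nx.
  have nadj b : b \in S -> ~~ e x b.
    move=> bS; apply: contra nx => exb; apply/finset.bigcupP; exists b => //.
    by rewrite !inE exb sA'A ?orbT.
  suff PxS : P (x |: S).
    have xS : x \in S by rewrite -(maxS _ PxS (finset.subsetUr _ _)) setU11.
    by case/negP: nx; apply/finset.bigcupP; exists x => //; rewrite setU11.
  apply/andP; split.
    by apply/fintype.subsetP=> y /setU1P[->//|/sSA'].
  apply/forall_inP=> y yxS; apply/forall_inP=> z zxS; apply/implyP.
  move: yxS zxS => /setU1P[->|yS] /setU1P[->|zS]; rewrite ?eqxx //.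
  - by rewrite nadj.
  - by rewrite esym nadj.
  - exact: indS'.
have le1 : #|A'| <= \sum_(b in S) #|b |: [set x in A | e x b]|.
  apply: leq_trans (subset_leq_card cover) _.
  elim/big_rec2: _ => [|b n B _ leB]; first by rewrite cards0.
  by apply: leq_trans (leq_card_setU _ _) _; rewrite leq_add2l.
(* Each [b] in [S] covers at most 1 + |A|/q elements. *)
apply: leq_trans (leq_mul (leqnn q) le1) _.
rewrite big_distrr /= -sum_nat_const; apply: leq_sum => b bS.
apply: (@leq_trans (q * (1 + #|[set x in A | e x b]|))).
  rewrite leq_mul2l; apply/orP; right.
  by apply: leq_trans (leq_card_setU _ _) _; rewrite cards1.
by rewrite mulnDr muln1 leq_add2l sparse // sSA'.
Qed.

End Trees.

Lemma stable_no_tree k (G : Defs.fgraph) : stable k G ->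
  ~ has_tree (@edge G) (tree_height (k + k)) [set: G] [set: G].
Proof.
move=> sG /has_tree_half[s [ss ps _]]; apply: sG.
have [k0|k0] := posnP k.
  rewrite k0; have f (i : 'I_0) : G by case: i.
  by exists f, f => [[]].
have [x0 _] : exists x0 : G * G, True.
  by case: s ss ps => [/= ss _|x ?]; [lia | exists x].
(* Even and odd positions never coincide, which avoids the diagonal, and i <= j becomes 2i <
   2j+1. *)
exists (fun i => (nth x0 s (i + i)).1), (fun j => (nth x0 s (j + j).+1).2).
move=> i j; have := ltn_ord i; have := ltn_ord j => ltj lti.
have /(pairwiseP x0) half := ps.
have [leij|ltji] := leqP i j; split=> //.
  have /andP[] // : half_rel (@edge G) (nth x0 s (i + i)) (nth x0 s (j + j).+1).
  by apply: half; rewrite ?inE ?ss; lia.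
have /andP[_ /negP] // : half_rel (@edge G) (nth x0 s (j + j).+1) (nth x0 s (i + i)).
by apply: half; rewrite ?inE ?ss; lia.
Qed.

Lemma large_homogeneous k (G : Defs.fgraph) q (d := tree_height (k + k)) :
  stable k G -> 0 < q -> q ^ d.+1 <= #|G| ->
  exists2 S : {set G}, clique S \/ anticlique S & q <= 4 * #|S|.
Proof.
move=> sG q0 leq_n.
have n0 : [set: G] != finset.set0.
  by rewrite -card_gt0 cardsT; apply: leq_trans leq_n; rewrite expn_gt0 q0.
have [[A [A0 gA leA]]|/stable_no_tree//] := good_or_tree (@edge G) d q0 n0.
have leqA : q <= #|A|.
  rewrite cardsT in leA; have := leq_trans leq_n leA.
  by rewrite expnS leq_pmul2r // expn_gt0 q0.
pose A1 := [set b in A | q * #|[set x in A | edge x b]| < #|A|].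
pose A0' := A :\: A1.
have cardA : #|A1| + #|A0'| = #|A|.
  rewrite -(cardsID A1 A); congr (_ + _); apply: eq_card => x.
  by rewrite !inE; case: (x \in A).
have [le1|le0] : #|A| <= 2 * #|A1| \/ #|A| <= 2 * #|A0'| by lia.
- have [||b|S indS leS] := @sparse_independent _ (@edge G) q A A1 q0.
  + exact: edge_sym.
  + by apply/fintype.subsetP=> x; rewrite inE => /andP[].
  + by rewrite inE => /andP[_ /ltnW].
  exists S; first by right.
  (* q|A| <= 2q|A1| <= 2|S|(q + |A|) <= 4|S||A|, and |A| > 0 cancels. *)
  nia.
(* Independent sets of the complement relation are cliques. *)
- have [||b|S indS leS] :=
    @sparse_independent _ (fun x y => ~~ @edge G x y) q A A0' q0.
  + by move=> x y; rewrite edge_sym.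
  + exact: finset.subsetDl.
  + rewrite !inE => /andP[+ bA]; rewrite bA /= => nb.
    by case: (gA b) => [|/ltnW//]; rewrite (negbTE nb).
  exists S; last nia.
  by left=> x y xS yS /(indS _ _ xS yS)/negPn.
Qed.

Lemma homogeneous_pair (G : Defs.fgraph) : 1 < #|G| ->
  exists2 S : {set G}, clique S \/ anticlique S & #|S| = 2.
Proof.
rewrite -cardsT => /card_gt1P[x [y [_ _ xy]]].
exists [set x; y]; last by rewrite cards2 xy.
case: (boolP (edge x y)) => exy; [left | right];
  by move=> u v /set2P[]-> /set2P[]->; rewrite ?eqxx // edge_sym.
Qed.

Lemma poly_homogeneous k (G : Defs.fgraph) (d := tree_height (k + k)) :
  stable k G ->
  exists2 S : {set G}, clique S \/ anticlique S & #|G| <= #|S| ^ (4 * d.+1).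
Proof.
move=> sG; have [n1|n1] := leqP #|G| 1.
  exists [set: G]; first by left=> x y _ _; rewrite (fintype_le1P n1 x y) eqxx.
  by rewrite cardsT; case: #|G| n1 => [|[|]] //; rewrite exp1n.
have [q leq_n ltn_q] : exists2 q, q ^ d.+1 <= #|G| & #|G| < q.+1 ^ d.+1.
  have ex0 : exists q, q ^ d.+1 <= #|G| by exists 0; rewrite exp0n.
  have bnd q : q ^ d.+1 <= #|G| -> q <= #|G|.
    by apply: leq_trans; rewrite -{1}(expn1 q); case: q => // q; rewrite leq_pexp2l.
  case: (ex_maxnP ex0 bnd) => q leq_n maxq; exists q => //.
  by rewrite ltnNge; apply/negP=> /maxq; rewrite ltnn.
have q0 : 0 < q.
  by case: q ltn_q {leq_n} => //; rewrite exp1n; lia.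
have [S [hS leS S2]] : exists S : {set G},
    [/\ clique S \/ anticlique S, q <= 4 * #|S| & 1 < #|S|].
  have [S hS leS] := large_homogeneous sG q0 leq_n.
  (* If |S| <= 1 then q <= 4, and any two vertices do. *)
  have [S1|S2] := leqP #|S| 1; last by exists S.
  have [S' hS' S'2] := homogeneous_pair n1.
  by exists S'; split=> //; lia.
exists S => //; apply: leq_trans (ltnW ltn_q) _.
rewrite expnM leq_exp2r //.
(* With s = |S| >= 2, q + 1 <= 4s + 1 <= s^4. *)
have sq : #|S| ^ 4 = #|S| ^ 2 * #|S| ^ 2 by rewrite -expnD.
rewrite sq -mulnn; nia.
Qed.

Local Open Scope ring_scope.

Theorem theorem1p2 (R : realType) (k : nat) : erdos_hajnal R (stable k).
Proof.
pose c := (4 * (tree_height (k + k)).+1)%N.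
have c0 : (0 : R) < c%:R by rewrite ltr0n.
exists c%:R^-1; first by rewrite invr_gt0.
move=> G /poly_homogeneous[S hS leS]; exists S => //.
have -> : #|S|%:R = ((#|S|%:R : R) ^+ c) `^ c%:R^-1.
  by rewrite -powR_mulrn // -powRrM divff ?gt_eqF // powRr1.
apply: ge0_ler_powR; rewrite ?nnegrE ?invr_ge0 ?exprn_ge0 //.
by rewrite -natrX ler_nat.
Qed.
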